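(* Let $\mathbf{x}$ be a linearly recurrent infinite word and let $\boldsymbol{\tau}=(\tau_n\colon \mathcal{A}_{n+1}^*\to\mathcal{A}_n^*,\ a_n\in\mathcal{A}_n)_{n\ge 0}$ be a congenial sequence generating $\mathbf{x}$ that satisfies the following three conditions: (P) there exists $k\in\mathbb{N}$ such that $\tau_{n,n+k}$ is positive for all $n\ge 0$; (F) the set $\{\tau_n : n\ge 0\}$ is finite; (D) for every $n\ge 0$, the substitution $\tau_n$ is decisive in $\mathbf{x}^{(n+1)}$. For $n\ge 0$ let $\mathbf{x}^{(n)}$ denote the limit of $(\tau_{n,m}(a_m))_{m>n}$. Suppose that there is a sequence $(B_n)_{n\ge 0}$ of positive reals such that $\mathbf{x}^{(n)}$ is $B_n$-letter-balanced for every $n\ge 0$. Then $\mathbf{x}$ is factor-balanced. Moreover, if the sequence $(B_n)_{n\ge 0}$ is bounded, then $\mathbf{x}$ is uniformly factor-balanced.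
   Context: Words: for finite words $u,w$, $|u|_w$ denotes the number of (possibly overlapping) occurrences of $w$ in $u$; $\mathcal{L}(\mathbf{x})$ is the set of finite factors of an infinite word $\mathbf{x}$. For $C>0$, a finite word $w$ is $C$-balanced in $\mathbf{x}$ if $\big||u|_w-|v|_w\big|\le C$ for all $u,v\in\mathcal{L}(\mathbf{x})$ with $|u|=|v|$. $\mathbf{x}$ is $C$-letter-balanced if every letter is $C$-balanced in $\mathbf{x}$; factor-balanced if each finite word $w$ is $C_w$-balanced in $\mathbf{x}$ for some constant $C_w>0$; uniformly factor-balanced if there is one $C>0$ such that every finite word is $C$-balanced in $\mathbf{x}$. Linear recurrence: for nonempty $u\in\mathcal{L}(\mathbf{x})$, a return word to $u$ is a word $w$ with $wu\in\mathcal{L}(\mathbf{x})$ such that $u$ occurs exactly twice in $wu$ (as a prefix and as a suffix). $\mathbf{x}$ is linearly recurrent (with constant $L$) if every factor occurs infinitely often, return word sets are nonempty, and $|w|\le L|u|$ for every nonempty $u\in\mathcal{L}(\mathbf{x})$ and every return word $w$ to $u$. Congenial sequences: $(\mathcal{A}_n)_{n\ge0}$ are finite alphabets, $\tau_n\colon\mathcal{A}_{n+1}^*\to\mathcal{A}_n^*$ are substitutions (monoid morphisms), $a_n\in\mathcal{A}_n$, and $\tau_n(a_{n+1})$ begins with $a_n$ for all $n$. For $n>m\ge0$, $\tau_{m,n}=\tau_m\circ\tau_{m+1}\circ\cdots\circ\tau_{n-1}$. Then $\tau_{m,n}(a_n)$ is a prefix of $\tau_{m,n+1}(a_{n+1})$,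 so $\mathbf{x}^{(m)}=\lim_{n\to\infty}\tau_{m,n}(a_n)$ exists (in $\mathcal{A}_m^{\mathbb{N}}\cup\mathcal{A}_m^*$); the sequence generates $\mathbf{x}=\mathbf{x}^{(0)}$. $\tau_{m,n}$ is positive if every $b\in\mathcal{A}_m$ occurs in $\tau_{m,n}(a)$ for every $a\in\mathcal{A}_n$. Decisiveness: for $\mathbf{y}\in\mathcal{A}^{\mathbb{N}}$ and $k\in\mathbb{N}$, a substitution $\tau\colon\mathcal{A}^*\to\mathcal{B}^*$ is $k$-decisive in $\mathbf{y}$ if there is a map $r\colon\mathcal{A}\to\mathcal{B}^k$ such that $\tau(b)$ begins with $r(a)$ for all letters $a,b$ with $ab\in\mathcal{L}(\mathbf{y})$; ''decisive'' means $k$-decisive for some $k\ge1$. *)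

(* Defs.v *)
From HB Require Import structures.
From mathcomp Require Import all_boot all_order all_algebra finmap.
From mathcomp Require Import classical_sets functions cardinality reals.

Set Implicit Arguments.
Unset Strict Implicit.
Unset Printing Implicit Defensive.

Import Order.TTheory GRing.Theory Num.Theory.

Local Open Scope ring_scope.

(* Elements of A^* \cup A^N.  Limits of sequences of finite words live here. *)
Inductive word (A : Type) := Fin of seq A | Inf of (nat -> A).

Section Words.
Variable A : eqType.
Implicit Types (u v w : seq A) (x : nat -> A) (y : word A).

Definition occurs_at x u (i : nat) : Prop :=
  mkseq (fun j => x (i + j)%N) (size u) = u.

Definition factor y u : Prop :=
  match y with
  | Fin s => infix u s
  | Inf x => exists i, occurs_at x u i
  end.

Definition converges (s : nat -> seq A) y : Prop :=
  match y with
  | Fin w => exists N, forall n, (N <= n)%N -> s n = w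
  | Inf x => forall l, exists N, forall n, (N <= n)%N -> prefix (mkseq x l) (s n)
  end.

(* The number of occurrences |u|_w; the empty word occurs at all |u| + 1
   positions of u. *)
Definition occ w u : nat :=
  count (fun i => prefix w (drop i u)) (iota 0 (size u).+1).

Definition return_word x u w : Prop :=
  [/\ factor (Inf x) (w ++ u), prefix u (w ++ u) & occ u (w ++ u) = 2%N].

Variable R : realType.

Definition balanced (C : R) y w : Prop :=
  forall u v, factor y u -> factor y v -> size u = size v ->
    `|(occ w u)%:R - (occ w v)%:R| <= C.

Definition letter_balanced (C : R) y : Prop :=
  forall a : A, balanced C y [:: a].

Definition factor_balanced y : Prop :=
  forall w, exists2 C : R, 0 < C & balanced C y w.

Definition uniformly_factor_balanced y : Prop :=
  exists2 C : R, 0 < C & forall w, balanced C y w.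

Definition linearly_recurrent_with (L : R) x : Prop :=
  [/\ forall u, factor (Inf x) u ->
        forall N, exists2 i, (N <= i)%N & occurs_at x u i,
      forall u, u != [::] -> factor (Inf x) u -> exists w, return_word x u w
    & forall u w, u != [::] -> factor (Inf x) u -> return_word x u w ->
        (size w)%:R <= L * (size u)%:R].

Definition linearly_recurrent x : Prop :=
  exists L : R, linearly_recurrent_with L x.

End Words.

Arguments factor_balanced {A} R y.
Arguments uniformly_factor_balanced {A} R y.
Arguments linearly_recurrent {A} R x.

(* A substitution A^* -> B^* is given by the images of the letters;
   [extend] is the induced monoid morphism. *)
Definition extend (A B : Type) (s : A -> seq B) (w : seq A) : seq B :=
  flatten (map s w).

Definition k_decisive (A B : eqType) (k : nat) (s : A -> seq B)
    (y : word A) : Prop :=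
  exists r : A -> k.-tuple B,
    forall a b, factor y [:: a; b] -> prefix (r a) (s b).

Definition decisive (A B : eqType) (s : A -> seq B) (y : word A) : Prop :=
  exists2 k, (0 < k)%N & k_decisive k s y.

(* A substitution bundled with its alphabets, so that substitutions between
   different alphabets can be compared. *)
Record substitution (K : choiceType) := Substitution {
  subst_dom : {fset K};
  subst_cod : {fset K};
  subst_fun : subst_dom -> seq subst_cod }.

(* The alphabets are finite subsets of an ambient set K of letters. *)
Section Sequences.
Variables (K : choiceType) (A : nat -> {fset K}).
Variables (tau : forall n, A n.+1 -> seq (A n)) (a : forall n, A n).

(* [comp_subst m d] is tau_{m,m+d}, restricted to letters.  The index is
   written d + m because (d.+1 + m)%N is convertible to (d + m)%N.+1. *)
Fixpoint comp_subst (m d : nat) : A (d + m)%N -> seq (A m) :=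
  match d return A (d + m)%N -> seq (A m) with
  | 0%N => fun c => [:: c]
  | d'.+1 => fun c => extend (@comp_subst m d') (@tau (d' + m)%N c)
  end.

Definition positive (m d : nat) : Prop :=
  forall (c : A (d + m)%N) (b : A m), b \in comp_subst c.

Definition congenial : Prop :=
  forall n, prefix [:: a n] (tau (a n.+1)).

(* y is the limit of (tau_{m,n}(a_n))_{n > m}. *)
Definition limit_word (m : nat) (y : word (A m)) : Prop :=
  converges (fun d => @comp_subst m d.+1 (a (d.+1 + m)%N)) y.

Definition uniformly_positive : Prop :=
  exists2 k, (0 < k)%N & forall n, positive n k.

Definition finitely_many : Prop :=
  finite_set (range (fun n => Substitution (@tau n))).

End Sequences.

(* Main.v *)
Require Import Defs.
From HB Require Import structures.
From mathcomp Require Import all_boot all_order all_algebra finmap.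
From mathcomp Require Import boolp classical_sets functions cardinality reals.
From mathcomp Require Import zify.

Set Implicit Arguments.
Unset Strict Implicit.
Unset Printing Implicit Defensive.

Import Order.TTheory GRing.Theory Num.Theory.

(* Put the blocks tau_{0,n}(x^{(n)}_i) end to end to read x.  If |w| is at most
   every |tau_{0,n-1}(c)|, decisiveness of tau_{n-1} makes the occurrences of w
   starting inside a block depend only on the letter x^{(n)}_i, so |u|_w is, up
   to boundary terms, a weighted letter count of the desubstituted word.  Two
   factors of x of equal length desubstitute to words whose lengths differ by a
   bounded amount, because x^{(n)} is letter-balanced and, by positivity and
   finiteness, the lengths |tau_{0,n}(c)| are within a constant factor of each
   other; hence letter balance of x^{(n)} gives balance of w.

   Taking n minimal, |tau_{0,n}(c)| is at most a constant times |w|.  If x is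
   not periodic, linear recurrence keeps occurrences of w at distance at least
   a constant times |w|, so the weights are bounded independently of w and the
   bound is uniform.  A periodic x is handled by the same counting argument
   with blocks equal to the period. *)

Lemma big_shift (F : nat -> nat) i n :
  \sum_(i <= t < i + n) F t = \sum_(0 <= t < n) F (i + t).
Proof.
rewrite -[X in \sum_(X <= _ < _) _]add0n big_addn addKn.
by apply: eq_bigr => t _; rewrite addnC.
Qed.

(** * Occurrences in windows of an infinite word *)

Section Windows.
Variable T : eqType.
Implicit Types (x : nat -> T) (u v w : seq T).

Definition window x i m := mkseq (fun j => x (i + j)) m.

Definition occurs x w i : bool := window x i (size w) == w.

Lemma occursP x w i : reflect (occurs_at x w i) (occurs x w i).
Proof. exact: eqP. Qed.

Lemma size_window x i m : size (window x i m) = m.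
Proof. exact: size_mkseq. Qed.

Lemma nth_window c x i m j : j < m -> nth c (window x i m) j = x (i + j).
Proof. by move=> lt_jm; rewrite nth_mkseq. Qed.

Lemma drop_window x i m j : drop j (window x i m) = window x (i + j) (m - j).
Proof.
apply: (@eq_from_nth _ (x 0)) => [|t]; first by rewrite size_drop !size_window.
rewrite size_drop size_window => lt_t.
by rewrite nth_drop !nth_window ?addnA //; lia.
Qed.

Lemma take_window x i m j : take j (window x i m) = window x i (minn j m).
Proof. by rewrite /window /mkseq -map_take take_iota. Qed.

Lemma cat_window x i m n :
  window x i m ++ window x (i + m) n = window x i (m + n).
Proof.
rewrite -[RHS](cat_take_drop m) take_window drop_window addKn.
by rewrite (minn_idPl (leq_addr _ _)).
Qed.

Lemma window_occurs x i m : occurs x (window x i m) i.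
Proof. by rewrite /occurs size_window. Qed.

Lemma occursE c x w i :
  occurs x w i -> forall j, j < size w -> x (i + j) = nth c w j.
Proof.
move=> /eqP Ew j lt_j; rewrite -(nth_window c x i lt_j).
by rewrite Ew.
Qed.

(** An empty [w] would be a prefix even for [t > m], where the length test fails. *)
Lemma prefix_drop_window x w i m t : w != [::] ->
  prefix w (drop t (window x i m)) = (size w + t <= m) && occurs x w (i + t).
Proof.
move=> w0; rewrite prefixE drop_window take_window /occurs.
case: (leqP (size w + t) m) => [le_m|lt_m] /=.
  by rewrite (minn_idPl _) //; lia.
have sz0 : 0 < size w by case: (w) w0.
apply: negbTE; apply/eqP => /(congr1 size); rewrite size_window.
by rewrite (minn_idPr _); lia.
Qed.

Lemma occ_window x w i m : w != [::] ->
  occ w (window x i m) = \sum_(i <= t < i + (m.+1 - size w)) occurs x w t.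
Proof.
move=> w0; rewrite /occ size_window big_shift.
rewrite -sum1_count -/(index_iota 0 m.+1) big_mkcond.
rewrite (@big_cat_nat _ _ _ (m.+1 - size w)) ?leq_subr //=.
rewrite [X in _ + X]big_nat_cond [X in _ + X]big1 ?addn0 => [|t].
  apply: eq_big_nat => t lt_t; rewrite prefix_drop_window //.
  have -> : size w + t <= m by lia.
  by case: (occurs _ _ _).
rewrite andbT prefix_drop_window // => lt_t.
by have -> : (size w + t <= m) = false by lia.
Qed.

Lemma factor_window x u : factor (Inf x) u -> exists i, u = window x i (size u).
Proof. by case=> i ui; exists i. Qed.

Lemma window_factor x i m : factor (Inf x) (window x i m).
Proof. by exists i; apply/occursP/window_occurs. Qed.

(* [j] is the position of the last occurrence in the window. *)
Lemma sum_occurs_last x w D p n :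
    (forall s t, s < t -> occurs x w s -> occurs x w t ->
      size w <= D * (t - s)) ->
  \sum_(p <= t < p + n) occurs x w t = 0 \/
  exists j, [/\ p <= j < p + n, occurs x w j &
    size w * (\sum_(p <= t < p + n) occurs x w t) <= D * (j - p) + size w].
Proof.
move=> gap; elim: n => [|n IHn]; first by left; rewrite addn0 big_geq.
rewrite addnS big_nat_recr ?leq_addr //=.
have [occ_n|nocc_n] := boolP (occurs x w (p + n)); last first.
  rewrite addn0; case: IHn => [->|[j [lt_j occ_j le_j]]]; [by left|right].
  by exists j; split=> //; lia.
right; exists (p + n); split=> //; first lia.
case: IHn => [->|[j [lt_j occ_j le_j]]]; first by lia.
rewrite mulnDr muln1 leq_add2r (leq_trans le_j) //.
have := gap j (p + n) _ occ_j occ_n.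
have -> : p + n - p = (j - p) + (p + n - j) by lia.
by rewrite mulnDr; lia.
Qed.

(** The last occurrence lies less than [H * size w] past [p]; dividing the estimate of
    [sum_occurs_last] by [size w] leaves [D * H + 1]. *)
Lemma sum_occurs_le x w D H p n :
    w != [::] ->
    (forall s t, s < t -> occurs x w s -> occurs x w t ->
      size w <= D * (t - s)) ->
    n <= H * size w ->
  \sum_(p <= t < p + n) occurs x w t <= D * H + 1.
Proof.
move=> w0 gap le_n; have sz0 : 0 < size w by case: (w) w0.
case: (sum_occurs_last p n gap) => [->//|[j [lt_j _ le_j]]].
rewrite -(leq_pmul2l sz0) (leq_trans le_j) //.
rewrite mulnDr muln1 leq_add2r mulnCA leq_mul2l mulnC.
by apply/orP; right; lia.
Qed.

End Windows.

(** * Sums over the blocks of a letter-balanced word *)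

Section BlockSums.
Variables (T : finType) (y : nat -> T) (b : nat).
Hypothesis y_balanced : forall c i j d,
  \sum_(i <= t < i + d) (y t == c) <= \sum_(j <= t < j + d) (y t == c) + b.

(** Grouped by letters, the sum weights each letter count by [g c <= G], and each count varies by at
    most [b]. *)
Lemma sum_letters_le (g : T -> nat) G i j d :
    (forall c, g c <= G) ->
  \sum_(i <= t < i + d) g (y t) <=
    \sum_(j <= t < j + d) g (y t) + #|T| * b * G.
Proof.
move=> le_G; have sumE k :
    \sum_(k <= t < k + d) g (y t) =
    \sum_c g c * \sum_(k <= t < k + d) (y t == c).
  under [RHS]eq_bigr do rewrite big_distrr /=.
  rewrite exchange_big /=; apply: eq_bigr => t _.
  rewrite (bigD1 (y t)) //= eqxx muln1 big1 ?addn0 // => c.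
  by rewrite eq_sym => /negbTE ->; rewrite muln0.
rewrite !sumE -mulnA -sum_nat_const -big_split /=; apply: leq_sum => c _.
apply: leq_trans (leq_mul (leqnn _) (y_balanced c i j d)) _.
by rewrite mulnDr leq_add2l mulnC leq_mul2l le_G orbT.
Qed.

Variables (o : nat -> nat) (h f : T -> nat) (lo Q F : nat).
Hypotheses (lo_gt0 : 0 < lo) (h_ge : forall c, lo <= h c).
Hypotheses (h_le : forall c, h c <= Q * lo) (f_le : forall c, f c <= F).

(** Start of block [i]. In use, [o] marks the occurrences of a word, [h] is the block length and [f]
    counts the occurrences starting in a block. *)
Definition cut i := \sum_(0 <= t < i) h (y t).

Hypothesis block_sum :
  forall i, \sum_(cut i <= t < cut i.+1) o t = f (y i).

Lemma cutS i : cut i.+1 = cut i + h (y i).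
Proof. by rewrite /cut big_nat_recr. Qed.

Let cut_sum i d : cut (i + d) = cut i + \sum_(i <= t < i + d) h (y t).
Proof. by rewrite /cut -big_cat_nat ?leq_addr. Qed.

Let leq_cut i j : i <= j -> cut i <= cut j.
Proof. by move=> /subnKC <-; rewrite cut_sum leq_addr. Qed.

Let cut_block p : {i | cut i <= p < cut i.+1}.
Proof.
elim: p => [|p [i /andP[le_p lt_p]]].
  exists 0; rewrite cutS /cut big_geq //=; exact: leq_trans (h_ge _).
case: (ltnP p.+1 (cut i.+1)) => [lt_p1|le_p1]; first by exists i; lia.
exists i.+1; rewrite le_p1 cutS; have := h_ge (y i.+1); lia.
Qed.

Let block_sums i d :
  \sum_(cut i <= t < cut (i + d)) o t = \sum_(i <= t < i + d) f (y t).
Proof.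
elim: d => [|d IHd]; first by rewrite addn0 !big_geq.
rewrite addnS [RHS]big_nat_recr ?leq_addr //= -IHd -block_sum.
by rewrite -big_cat_nat ?leq_cut ?leq_addr.
Qed.

Let sum_inside i p q : cut i <= p -> p <= q -> q <= cut i.+1 ->
  \sum_(p <= t < q) o t <= F.
Proof.
move=> le1 le2 le3; apply: leq_trans (f_le (y i)); rewrite -block_sum.
rewrite [leqRHS](@big_cat_nat _ _ _ p) ?(leq_trans le2) //=.
by rewrite [X in _ + X](@big_cat_nat _ _ _ q) //= addnCA leq_addr.
Qed.

(* Rounding both windows down to cut points costs at most one block at each
   end; the two resulting words over [T] have lengths that differ by at most
   [(2 + #|T| * b) * Q] letters, and agree up to balance on their common
   length. *)
Lemma window_sums_balanced p q m :
  \sum_(p <= t < p + m) o t <=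
    \sum_(q <= t < q + m) o t +
    F * (2 + #|T| * b + (2 + #|T| * b) * Q).
Proof.
have [i /andP[le_i lt_i]] := cut_block p.
have [i' /andP[le_i' lt_i']] := cut_block (p + m).
have [j /andP[le_j lt_j]] := cut_block q.
have [j' /andP[le_j' lt_j']] := cut_block (q + m).
have mono k k' s t : cut k <= s -> s <= t -> t < cut k'.+1 -> k <= k'.
  move=> le_s le_t lt_t; rewrite leqNgt; apply/negP => lt_k.
  by have := leq_cut lt_k; lia.
have le_ii' : i <= i' by apply: mono le_i _ lt_i'; lia.
have le_jj' : j <= j' by apply: mono le_j _ lt_j'; lia.
have up : \sum_(p <= t < p + m) o t <=
    \sum_(cut i <= t < cut i') o t + F.
  have : \sum_(p <= t < p + m) o t <= \sum_(cut i <= t < p + m) o t.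
    by rewrite [leqRHS](@big_cat_nat _ _ _ p) ?leq_addr //= leq_addl.
  move=> /leq_trans -> //; rewrite (@big_cat_nat _ _ _ (cut i')) ?leq_cut //=.
  rewrite leq_add2l; apply: sum_inside (leqnn _) _ _ => //; exact: ltnW.
have down : \sum_(cut j <= t < cut j') o t <= \sum_(q <= t < q + m) o t + F.
  have : \sum_(cut j <= t < cut j') o t <= \sum_(cut j <= t < q + m) o t.
    by rewrite [leqRHS](@big_cat_nat _ _ _ (cut j')) ?leq_cut //= leq_addr.
  move=> /leq_trans -> //; rewrite (@big_cat_nat _ _ _ q) ?leq_addr //= addnC.
  rewrite leq_add2l; apply: sum_inside (leqnn _) _ _ => //; exact: ltnW.
move: le_ii' le_jj' => /subnKC Ei /subnKC Ej.
set d := i' - i in Ei; set e := j' - j in Ej.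
rewrite -Ei block_sums in up; rewrite -Ej block_sums in down.
suff : \sum_(i <= t < i + d) f (y t) <= \sum_(j <= t < j + e) f (y t) +
    F * (#|T| * b + (2 + #|T| * b) * Q) by rewrite !mulnDr; lia.
have [le_de|lt_ed] := leqP d e.
  apply: leq_trans (sum_letters_le i j d f_le) _.
  apply: leq_add; last by rewrite mulnC leq_mul2l leq_addr orbT.
  by rewrite [leqRHS](@big_cat_nat _ _ _ (j + d)) ?leq_addr ?leq_add2l.
have [e' Ed] : exists e', d = e + e' by exists (d - e); lia.
rewrite Ed addnA (@big_cat_nat _ _ _ (i + e)) ?leq_addr //= mulnDr addnA.
apply: leq_add.
  by rewrite [F * _]mulnC; exact: sum_letters_le.
(* The [d] blocks from [i] cover less than [m + h (y i)], the [e] blocks from [j] more than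
   [m - h (y j')]. Comparing the first [e] blocks of each by balance bounds the total length of the
   [e'] surplus blocks. *)
have le_e' : e' * lo <= (2 + #|T| * b) * Q * lo.
  rewrite -mulnA mulnDl; have := sum_letters_le j i e h_le.
  have := cut_sum j e; rewrite Ej.
  have := cut_sum (i + e) e'; rewrite -addnA -Ed Ei.
  have := cut_sum i e.
  have : e' * lo <= \sum_(i + e <= t < i + e + e') h (y t).
    rewrite -[e' in e' * _](addKn (i + e)) -sum_nat_const_nat.
    exact: leq_sum.
  rewrite -addnA -Ed Ei; move: lt_i lt_j'; rewrite !cutS.
  have := h_le (y i); have := h_le (y j'); lia.
rewrite leq_pmul2r // in le_e'.
apply: leq_trans (leq_mul (leqnn F) le_e').
rewrite mulnC -[e' in e' * _](addKn (i + e)) -sum_nat_const_nat.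
exact: leq_sum.
Qed.

End BlockSums.

(** * Periodicity and the spacing of occurrences *)

Section Recurrence.
Variables (T : eqType) (x : nat -> T).

(** Blocks of length [q] are coded by the constant word over [unit], for which [b = 0], [lo = F = q]
    and [Q = 1]; the error is then [q * (2 + 2)]. *)
Lemma periodic_balanced q w p1 p2 m :
    0 < q -> (forall i, x (i + q) = x i) ->
  \sum_(p1 <= t < p1 + m) occurs x w t <=
    \sum_(p2 <= t < p2 + m) occurs x w t + q * 4.
Proof.
move=> q_gt0 x_per.
have occ_per i t : occurs x w (i * q + t) = occurs x w t.
  elim: i => [//|i IHi]; rewrite mulSn -addnA addnC -IHi /occurs.
  congr (_ == _); apply: eq_map => j.
  by rewrite -addnA [q + j]addnC addnA x_per.
pose f (c : unit) : nat := \sum_(0 <= t < q) occurs x w t.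
have cutE i : cut (fun=> tt) (fun=> q) i = i * q.
  by rewrite /cut sum_nat_const_nat subn0.
have := @window_sums_balanced unit (fun=> tt) 0 _ (occurs x w) (fun=> q) f
  q 1 q q_gt0 _ _ _ _ p1 p2 m.
rewrite card_unit muln0 addn0 muln1; apply=> //.
- by case=> i j d; rewrite !big_shift addn0.
- by rewrite mul1n.
- rewrite /f => _; rewrite -[leqRHS]subn0 -[leqRHS]muln1 -sum_nat_const_nat.
  by apply: leq_sum => t _; exact: leq_b1.
move=> i; rewrite !cutE mulSn addnC big_shift /f.
by apply: eq_bigr => t _; rewrite occ_per.
Qed.

(** The last occurrence up to [i] and the first one from [i] on are separated by a return word. The
    occurrence at [i0] is there because return words do not bound the position of the first
    occurrence. *)
Lemma next_occurrence (R : realType) (L : R) (l : nat) v i0 i :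
    linearly_recurrent_with L x -> (L <= l%:R)%R ->
    v != [::] -> occurs x v i0 -> i0 <= i ->
  exists2 j, i <= j <= i + l * size v & occurs x v j.
Proof.
case=> rec _ ret le_Ll v0 occ_i0 le_i0.
have v_fac : factor (Inf x) v by exists i0; apply/occursP.
pose before k := (k <= i) && occurs x v k.
have ex_before : exists k, before k by exists i0; rewrite /before le_i0.
have [p /andP[le_pi occ_p] p_max] :=
  ex_maxnP ex_before (fun k (bk : before k) => proj1 (andP bk)).
move: le_pi; rewrite leq_eqVlt => /predU1P[<-|lt_pi].
  by exists p => //; rewrite leqnn leq_addr.
pose after k := (i <= k) && occurs x v k.
have ex_after : exists k, after k.
  by have [k le_k /occursP occ_k] := rec v v_fac i; exists k; apply/andP.
have [p' /andP[le_ip' occ_p'] p'_min] := ex_minnP ex_after.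
have lt_pp' : p < p' by exact: leq_trans le_ip'.
have none t : p.+1 <= t < p' -> occurs x v t = 0 :> nat.
  move=> /andP[lt_pt lt_tp']; apply/eqP; rewrite eqb0; apply/negP => occ_t.
  have [le_ti|lt_it] := leqP t i.
    by have := p_max t; rewrite /before le_ti occ_t => /(_ isT); lia.
  by have := p'_min t; rewrite /after (ltnW lt_it) occ_t => /(_ isT); lia.
have Ew : window x p (p' - p) ++ v = window x p (p' - p + size v).
  rewrite -cat_window subnKC 1?ltnW //; congr (_ ++ _).
  by apply/esym/eqP; exact: occ_p'.
have ret_w : return_word x v (window x p (p' - p)).
  split; rewrite Ew; first exact: window_factor.
    rewrite -[window _ _ _]drop0 prefix_drop_window // !addn0 leq_addl.
    exact: occ_p.
  rewrite occ_window // -addSn addnK addnS subnKC 1?ltnW //.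
  rewrite big_nat_recr ?(ltnW lt_pp') //= big_ltn // occ_p occ_p'.
  by rewrite big_nat (eq_bigr (fun=> 0)) ?big1.
have := ret _ _ v0 v_fac ret_w; rewrite size_window.
move=> /le_trans/(_ (ler_wpM2r (ler0n _ _) le_Ll)).
rewrite -natrM ler_nat => le_p.
by exists p' => //; lia.
Qed.

(* If [w] occurs at distance [q], both occurrences overlap in a word of period
   [q]; if [w] is long, linear recurrence makes every factor of length [q + 1]
   occur in it, so that [x] itself has period [q]. *)
Lemma periodic_or_gap (R : realType) : linearly_recurrent R x ->
  (exists2 q, 0 < q & forall i, x (i + q) = x i) \/
  (exists D, forall w s t, s < t -> occurs x w s -> occurs x w t ->
     size w <= D * (t - s)).
Proof.
case=> L Lrec; pose l := Num.bound `|L|%R.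
have le_Ll : (L <= l%:R)%R.
  exact: le_trans (ler_norm L) (ltW (archi_boundP (normr_ge0 L))).
have [?|nper] := pselect (exists2 q, 0 < q & forall i, x (i + q) = x i).
  by left.
(* A factor of length [q + 1] reappears within [l * (q + 1) <= 2 * l * q], which is less than
   [size w]. *)
right; exists (l * 2 + 1) => w s t lt_st occ_s occ_t.
rewrite leqNgt; apply/negP => lt_w; apply: nper; exists (t - s).
  by rewrite subn_gt0.
set q := t - s in lt_w *; have q_gt0 : 0 < q by rewrite subn_gt0.
have Et : t = s + q by rewrite subnKC // ltnW.
have shift j : j < size w -> x (s + j + q) = x (s + j).
  move=> lt_j; rewrite addnAC -Et (occursE (x 0) occ_t lt_j).
  by rewrite (occursE (x 0) occ_s lt_j).
move=> i; pose W := window x s (q + size w).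
have [rec _ _] := Lrec.
(* A copy of [W] to the right of [i] is used, so that the factor at [i] is the earlier occurrence
   required by [next_occurrence]. *)
have [k le_ik /occursP occ_k] := rec W (window_factor _ _ _) i.
have kE j : j < q + size w -> x (k + j) = x (s + j).
  move=> lt_j; rewrite (occursE (x 0) occ_k) ?size_window //.
  exact: nth_window.
have v0 : window x i q.+1 != [::] by rewrite -size_eq0 size_window.
have [p /andP[le_kp le_p] occ_p] :=
  next_occurrence Lrec le_Ll v0 (window_occurs x i q.+1) le_ik.
rewrite size_window in le_p.
have pE j : j < q.+1 -> x (i + j) = x (p + j).
  move=> lt_j; rewrite (occursE (x 0) occ_p) ?size_window //.
  by rewrite nth_window.
have [j Ep] : exists j, p = k + j by exists (p - k); rewrite subnKC.
have lt_jw : j < size w by nia.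
rewrite pE // -[i in RHS]addn0 pE // addn0 Ep -addnA !kE; try lia.
by rewrite addnA shift.
Qed.

End Recurrence.

(** * Substitutions, limit words and block lengths *)

Section Extend.
Variables (S T : eqType).
Implicit Types (f : S -> seq T) (v w : seq S).

Lemma extend_cat f v w : extend f (v ++ w) = extend f v ++ extend f w.
Proof. by rewrite /extend map_cat flatten_cat. Qed.

Lemma size_extend f w : size (extend f w) = \sum_(c <- w) size (f c).
Proof.
elim: w => [|c w IHw]; first by rewrite big_nil.
by rewrite big_cons -IHw -size_cat.
Qed.

Lemma size_extend_le f w G :
  (forall c, size (f c) <= G) -> size (extend f w) <= size w * G.
Proof.
move=> le_G; rewrite size_extend -sum1_size big_distrl /=.
by apply: leq_sum => c _; rewrite mul1n.
Qed.

Lemma size_extend_ge f w c : c \in w -> size (f c) <= size (extend f w).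
Proof. by move=> cw; rewrite size_extend (big_rem c) //= leq_addr. Qed.

End Extend.

Lemma extend_extend (S T U : eqType) (f : T -> seq U) (g : S -> seq T) w :
  extend f (extend g w) = extend (fun c => extend f (g c)) w.
Proof. by elim: w => //= c w IHw; rewrite extend_cat IHw. Qed.

Section Images.
Variables (K : choiceType) (A : nat -> {fset K}).
Variables (tau : forall n, A n.+1 -> seq (A n)) (a : forall n, A n).

(* tau_{0,n}; unlike [comp_subst tau 0 n] its domain is [A n] on the nose. *)
Fixpoint image n : A n -> seq (A 0) :=
  match n with
  | 0 => fun c => [:: c]
  | n'.+1 => fun c => extend (@image n') (@tau n' c)
  end.

Lemma image_comp m d (c : A (d + m)) :
  image c = extend (@image m) (comp_subst tau c).
Proof.
elim: d c => [|d IHd] c; first by rewrite /= /extend /= cats0.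
rewrite /= extend_extend; congr flatten; exact: eq_map.
Qed.

Lemma limit_image x : limit_word tau a (Inf x) ->
  forall l, exists N, forall n, N <= n -> prefix (mkseq x l) (image (a n)).
Proof.
move=> x_lim l; have [N prefN] := x_lim l; exists N.+1 => -[//|n] le_Nn.
have := prefN n le_Nn.
have -> : comp_subst tau (a (n.+1 + 0)) = image (a (n.+1 + 0)).
  by rewrite image_comp /extend flatten_seq1.
by rewrite addn0.
Qed.

(** A finite limit [u] would make [image (a n)] eventually equal to the image of [u], too short to
    have long prefixes of [x]. *)
Lemma limit_word_infinite (x : nat -> A 0) m (z : word (A m)) :
  limit_word tau a (Inf x) -> limit_word tau a z -> exists y, z = Inf y.
Proof.
move=> x_lim; case: z => [u [N uN]|y]; last by exists y.
have [N' x_pref] := limit_image x_lim (size (extend (@image m) u)).+1.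
have := x_pref ((N + N').+1 + m) _.
rewrite image_comp uN ?leq_addr // => /(_ ltac:(lia)) /size_prefix.
by rewrite size_mkseq ltnn.
Qed.

(** For large [n], both the image of a prefix of [y] and a prefix of [x] of the same length are
    prefixes of [image (a n)]. *)
Lemma limit_word_image x m (y : nat -> A m) :
    limit_word tau a (Inf x) -> limit_word tau a (Inf y) ->
  forall l, extend (@image m) (mkseq y l) =
    mkseq x (size (extend (@image m) (mkseq y l))).
Proof.
move=> x_lim y_lim l; set u := extend _ _.
have [N y_pref] := y_lim l; have [N' x_pref] := limit_image x_lim (size u).
have := x_pref ((N + N').+1 + m) ltac:(lia).
have /prefixP[v] := y_pref (N + N') (leq_addr _ _).
rewrite image_comp => ->; rewrite extend_cat -/u prefixE size_mkseq.
by rewrite take_size_cat // => /eqP.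
Qed.

Lemma cut_image m (y : nat -> A m) i :
  cut y (fun c => size (image c)) i = size (extend (@image m) (mkseq y i)).
Proof.
by rewrite size_extend /mkseq big_map /cut /index_iota subn0.
Qed.

Lemma window_blocks x m (y : nat -> A m) :
    limit_word tau a (Inf x) -> limit_word tau a (Inf y) ->
  forall i, window x (cut y (fun c => size (image c)) i) (size (image (y i))) =
    image (y i).
Proof.
move=> x_lim y_lim i; have := limit_word_image x_lim y_lim i.+1.
rewrite mkseqS -cats1 extend_cat cut_image.
set u := extend _ (mkseq y i).
have -> : extend (@image m) [:: y i] = image (y i) by rewrite /extend /= cats0.
rewrite size_cat => /(congr1 (drop (size u))); rewrite drop_size_cat // => Ex.
by rewrite [RHS]Ex -[mkseq x _]/(window x 0 _) drop_window addKn.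
Qed.

Section Sizes.
Variables (M k : nat).
Hypothesis tau_le : forall n (c : A n.+1), size (tau c) <= M.
Hypothesis tau_pos : forall n, positive tau n k.

Lemma size_image_le m G : (forall b : A m, size (image b) <= G) ->
  forall d (c : A (d + m)), size (image c) <= M ^ d * G.
Proof.
move=> le_G; elim=> [|d IHd] c; first by rewrite mul1n.
apply: leq_trans (size_extend_le _ (IHd)) _.
by rewrite expnS -mulnA leq_mul2r tau_le orbT.
Qed.

Lemma size_image_ge m (b : A m) (c : A (k + m)) :
  size (image b) <= size (image c).
Proof. by rewrite [image c]image_comp size_extend_ge ?tau_pos. Qed.

(** Take the least [j] such that all images at level [k + j] reach length [l], and [n = k + j]. With
    [lo] the longest image at level [j + 1], positivity over [k] levels gives the lower bound and
    [M ^ k] the growth. *)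
Lemma exists_level (x : nat -> A 0) l :
    0 < M -> limit_word tau a (Inf x) -> 0 < l ->
  exists n lo, [/\ forall c : A n, l <= size (image c), 0 < lo,
    forall c : A n.+1, lo <= size (image c) <= M ^ k * lo &
    forall c : A n.+1, size (image c) <= M ^ k.+2 * l].
Proof.
move=> M_gt0 x_lim l_gt0.
pose long j := [forall c : A (k + j), l <= size (image c)].
have ex_long : exists j, long j.
  have [N x_pref] := limit_image x_lim l; exists N; apply/forallP => c.
  apply: leq_trans (size_image_ge (a N) c).
  by have /size_prefix := x_pref N (leqnn N); rewrite size_mkseq.
have [j /forallP long_j j_min] := ex_minnP ex_long.
pose lo := \max_(b : A j.+1) size (image b).
have le_lo (c : A (k + j.+1)) : lo <= size (image c) <= M ^ k * lo.
  apply/andP; split; first by apply/bigmax_leqP => b _; exact: size_image_ge.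
  by apply: size_image_le => b; exact: leq_bigmax.
exists (k + j), lo; split=> //.
- have [lo0|//] := posnP lo.
  have [N x_pref] := limit_image x_lim 1.
  have := size_prefix (x_pref (N + j.+1) (leq_addr _ _)); rewrite size_mkseq.
  suff : size (image (a (N + j.+1))) <= M ^ N * 0.
    by rewrite muln0 leqn0 => /eqP ->.
  apply: size_image_le => b; move/eqP: lo0; rewrite -leqn0.
  exact/leq_trans/leq_bigmax.
- by rewrite -addnS.
case: j j_min {long_j lo le_lo} => [_|j j_min].
  move=> c; apply: leq_trans (@size_image_le 0 l _ k.+1 c) _ => //.
  by rewrite leq_mul2r leq_pexp2l ?orbT.
(* Minimality gives a short image [k] levels above [j]; it contains all images at level [j], which
   lies [k + 2] levels below the target. *)
have : ~~ long j by apply/negP => /j_min; rewrite ltnn.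
rewrite negb_forall => /existsP[c0]; rewrite -ltnNge => lt_c0.
rewrite addnS => c; apply: (@size_image_le j l _ k.+2 c) => b.
exact: leq_trans (size_image_ge b c0) (ltnW lt_c0).
Qed.
End Sizes.
End Images.

(** * Numerical consequences of finiteness, balance and decisiveness *)

Lemma finitely_many_bound (K : choiceType) (A : nat -> {fset K})
    (tau : forall n, A n.+1 -> seq (A n)) : finitely_many tau ->
  exists M, [/\ 0 < M, forall n (c : A n.+1), size (tau n c) <= M &
    forall n, #|{: A n}| <= M].
Proof.
pose bound (s : substitution K) :=
  \max_(c : subst_dom s) size (subst_fun c) + #|{: subst_cod s}|.
move=> /(finite_image bound)/finite_seqP[r Er].
have le_r n : bound (Substitution (@tau n)) <= \max_(i <- r) i.
  apply: leq_bigmax_seq => //.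
  have : [set` r]%classic (bound (Substitution (@tau n))).
    by rewrite -Er; exists (Substitution (@tau n)) => //; exists n.
  by [].
exists (\max_(i <- r) i).+1; split=> // n => [c|]; apply: leqW.
  apply: leq_trans (le_r n); apply: leq_trans (leq_addr _ _).
  exact: (@leq_bigmax _ (fun c => size (tau n c))).
exact: leq_trans (leq_addl _ _) (le_r n).
Qed.

Lemma dist_natr_le (R : realType) (C : R) m n k :
  (`|m%:R - n%:R| <= C)%R -> (C <= k%:R)%R -> m <= n + k.
Proof.
move=> le_C /(le_trans le_C); rewrite ler_norml => /andP[_].
by rewrite lerBlDl -natrD ler_nat.
Qed.

Lemma letter_balanced_sum (R : realType) (T : eqType) (y : nat -> T) (C : R) b :
    letter_balanced C (Inf y) -> (C <= b%:R)%R ->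
  forall c i j d,
    \sum_(i <= t < i + d) (y t == c) <= \sum_(j <= t < j + d) (y t == c) + b.
Proof.
move=> bal le_Cb c i j d.
have occE k : occ [:: c] (window y k d) = \sum_(k <= t < k + d) (y t == c).
  rewrite occ_window // subn1; apply: eq_bigr => t _.
  by rewrite /occurs /window /mkseq /= addn0 eqseq_cons andbT.
rewrite -!occE; apply: dist_natr_le le_Cb.
by apply: bal; rewrite ?size_window //; exact: window_factor.
Qed.

Lemma sum_balanced_word (R : realType) (T : eqType) (x : nat -> T) w C :
    (w != [::] -> forall p q m,
      \sum_(p <= t < p + m) occurs x w t <=
        \sum_(q <= t < q + m) occurs x w t + C) ->
  balanced (C%:R : R)%R (Inf x) w.
Proof.
move=> bal u v /factor_window[p ->] /factor_window[q ->].
rewrite !size_window => <-.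
(* The empty word occurs equally often in words of equal length. *)
have [->|w0] := eqVneq w [::].
  have occ0 (s : seq T) : occ [::] s = (size s).+1.
    rewrite /occ (eq_count (a2 := predT)) ?count_predT ?size_iota // => i.
    exact: prefix0s.
  by rewrite !occ0 !size_window subrr normr0 ler0n.
by rewrite !occ_window // ler_distl lerBlDr -!natrD !ler_nat !(bal w0).
Qed.

(** One forced letter is enough: at the chosen level its image is already as long as [w]. *)
Lemma decisive_next (T U : eqType) (s : T -> seq U) (y : nat -> T) :
    decisive s (Inf y) ->
  exists e : T -> U, forall i, prefix [:: e (y i)] (s (y i.+1)).
Proof.
case=> k k_gt0 [r pref_r]; case: k k_gt0 r pref_r => // k _ r pref_r.
exists (fun c => thead (r c)) => i.
apply: prefix_trans (pref_r (y i) (y i.+1) _); last first.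
  by exists i; rewrite /occurs_at /mkseq /= addn0 addn1.
by case/tupleP: (r (y i)) => c t; rewrite theadE /= eqxx prefix0s.
Qed.

(** * Balance of a word read off at one level *)

Section Level.
Variables (K : choiceType) (A : nat -> {fset K}).
Variables (tau : forall n, A n.+1 -> seq (A n)) (a : forall n, A n).
Variables (x : nat -> A 0) (n : nat) (y : nat -> A n.+1).
Hypothesis x_lim : limit_word tau a (Inf x).
Hypothesis y_lim : limit_word tau a (Inf y).
Hypothesis tau_dec : decisive (@tau n) (Inf y).

Let block i := cut y (fun c => size (image tau c)) i.

(* By decisiveness, the block coming from the letter [y i] is followed by the
   tau_{0,n}-image of a letter determined by [y i]; this is long enough to
   decide which occurrences of [w] start inside the block. *)
Lemma block_occurrences w :
    w != [::] -> (forall c : A n, size w <= size (image tau c)) ->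
  exists f : A n.+1 -> nat,
    forall i, \sum_(block i <= t < block i.+1) occurs x w t = f (y i).
Proof.
move=> w0 w_le; have [e e_pref] := decisive_next tau_dec.
pose V c := image tau c ++ image tau (e c).
have windowV i : window x (block i) (size (V (y i))) = V (y i).
  have blocks := window_blocks x_lim y_lim.
  rewrite /V size_cat -cat_window blocks; congr (_ ++ _).
  have := blocks i.+1; rewrite -/(block i.+1).
  have [v Ev] := prefixP (e_pref i).
  have -> : image tau (y i.+1) =
      image tau (e (y i)) ++ extend (@image _ _ tau n) v.
    by rewrite [LHS]/= Ev extend_cat /extend /= cats0.
  rewrite /block cutS size_cat -cat_window => /eqP.
  by rewrite eqseq_cat ?size_window // => /andP[/eqP].
exists (fun c =>
  \sum_(0 <= t < size (image tau c)) prefix w (drop t (V c))) => i.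
rewrite /block cutS big_shift.
apply: eq_big_nat => t /andP[_ lt_t].
rewrite -[V (y i)]windowV prefix_drop_window //.
by rewrite (_ : _ <= _) // size_cat addnC leq_add // ltnW.
Qed.

Lemma level_balanced b k lo F w p q m :
    (forall c i j d,
      \sum_(i <= t < i + d) (y t == c) <=
        \sum_(j <= t < j + d) (y t == c) + b) ->
    w != [::] -> (forall c : A n, size w <= size (image tau c)) ->
    0 < lo -> (forall c : A n.+1, lo <= size (image tau c) <= k * lo) ->
    (forall i (c : A n.+1),
      \sum_(i <= t < i + size (image tau c)) occurs x w t <= F) ->
  \sum_(p <= t < p + m) occurs x w t <=
    \sum_(q <= t < q + m) occurs x w t +
    F * (2 + #|{: A n.+1}| * b + (2 + #|{: A n.+1}| * b) * k).
Proof.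
move=> y_bal w0 w_le lo_gt0 le_lo le_F.
have [f fE] := block_occurrences w0 w_le.
(* [f] is uncontrolled at letters absent from [y]; capping it at [F] bounds it everywhere and
   changes nothing along [y]. *)
apply: (@window_sums_balanced _ y b y_bal (occurs x w)
  (fun c => size (image tau c)) (fun c => minn (f c) F) lo k F) => //.
- by move=> c; case/andP: (le_lo c).
- by move=> c; case/andP: (le_lo c).
- by move=> c; exact: geq_minr.
move=> i; rewrite fE (minn_idPl _) // -fE /block cutS.
exact: le_F.
Qed.

End Level.

(** * Factor balance and its uniform version *)

Local Open Scope ring_scope.

Theorem theorem1p2 (R : realType) (K : choiceType) (A : nat -> {fset K})
    (tau : forall n : nat, A n.+1 -> seq (A n)) (a : forall n : nat, A n)
    (x : nat -> A 0%N) (xs : forall n : nat, word (A n)) (B : nat -> R)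
    (x_rec : linearly_recurrent R x)
    (tau_congenial : congenial tau a)
    (xs_lim : forall n : nat, limit_word tau a (xs n))
    (tau_generates_x : xs 0%N = Inf x)
    (tau_P : uniformly_positive tau)
    (tau_F : finitely_many tau)
    (tau_D : forall n : nat, decisive (@tau n) (xs n.+1))
    (B_gt0 : forall n : nat, 0 < B n)
    (xs_balanced : forall n : nat, letter_balanced (B n) (xs n)) :
  factor_balanced R (Inf x) /\
  ((exists M : R, forall n : nat, `|B n| <= M) ->
   uniformly_factor_balanced R (Inf x)).
Proof.
have x_lim : limit_word tau a (Inf x) by rewrite -tau_generates_x.
have [M [M_gt0 tau_le A_le]] := finitely_many_bound tau_F.
have [k _ tau_pos] := tau_P.
pose err b := (2 + M * b + (2 + M * b) * M ^ k)%N.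
(* The level [n] depends on [w] alone; [F] and [b] stay free, to be chosen with or without
   dependence on [w]. *)
have balanced_word w : w != [::] -> exists2 n, True & forall F b,
    (forall i j, (j <= M ^ k.+2 * size w)%N ->
      (\sum_(i <= t < i + j) occurs x w t <= F)%N) ->
    B n <= b%:R -> forall p q m,
  (\sum_(p <= t < p + m) occurs x w t <= \sum_(q <= t < q + m) occurs x w t +
     F * err b)%N.
  move=> w0; have sz0 : (0 < size w)%N by case: (w) w0.
  have [n [lo [w_le lo_gt0 le_lo le_M]]] :=
    exists_level tau_le tau_pos M_gt0 x_lim sz0.
  exists n.+1 => // F b le_F le_b p q m.
  have [y Ey] := limit_word_infinite x_lim (xs_lim n.+1).
  have y_lim : limit_word tau a (Inf y) by rewrite -Ey.
  have y_dec : decisive (@tau n) (Inf y) by rewrite -Ey.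
  have y_bal := xs_balanced n.+1; rewrite Ey in y_bal.
  have le_F' i (c : A n.+1) := le_F i _ (le_M c).
  apply: leq_trans (level_balanced x_lim y_lim y_dec p q m
    (letter_balanced_sum y_bal le_b) w0 w_le lo_gt0 le_lo le_F') _.
  have le_Mb := leq_mul (A_le n.+1) (leqnn b).
  by rewrite leq_add2l leq_mul2l leq_add ?orbT ?leq_mul // leq_add2l.
have boundP (C : R) : C <= (Num.bound `|C|)%:R.
  exact: le_trans (ler_norm C) (ltW (archi_boundP (normr_ge0 C))).
have uniform (P : seq (A 0%N) -> Prop) (C : nat) :
    (forall w, P w -> w != [::] -> forall p q m,
      (\sum_(p <= t < p + m) occurs x w t <=
        \sum_(q <= t < q + m) occurs x w t + C)%N) ->
  exists2 C : R, 0 < C & forall w, P w -> balanced C (Inf x) w.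
  move=> bal; exists C.+1%:R; first by rewrite ltr0n.
  move=> w Pw; apply: sum_balanced_word => w0 p q m.
  by apply: leq_trans (bal w Pw w0 p q m) _; rewrite leq_add2l leqW.
split=> [w|[b le_b]].
  have [->|w0] := eqVneq w [::].
    have [|C C_gt0 bal] := uniform (eq [::]) 0%N; first by move=> _ <-.
    by exists C; last exact: bal.
  have [n _ bal] := balanced_word w w0.
  (* Here [F] is the trivial bound, the maximal block length. *)
  have [|C C_gt0 balC] := uniform (eq w)
    (M ^ k.+2 * size w * err (Num.bound `|B n|))%N;
    last by exists C; last exact: balC.
  move=> _ <- _; apply: (bal _ _ _ (boundP (B n))) => i j le_j.
  apply: leq_trans le_j; rewrite -[leqRHS](addKn i) -[leqRHS]muln1.
  by rewrite -sum_nat_const_nat; apply: leq_sum => t _; exact: leq_b1.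
have [[q q_gt0 x_per]|[D gap]] := periodic_or_gap x_rec.
  have [|C C_gt0 bal] := uniform xpredT (q * 4)%N.
    by move=> w _ _ p1 p2 m; exact: periodic_balanced.
  by exists C => // w; exact: bal.
(* Blocks have length at most [M ^ k.+2 * size w], so the gap property yields an [F] independent of
   [w]. *)
have [|C C_gt0 bal] := uniform xpredT ((D * M ^ k.+2 + 1) *
    err (Num.bound `|b|))%N.
  move=> w _ w0; have [n _ bal] := balanced_word w w0.
  apply: bal; last first.
    exact: le_trans (ler_norm _) (le_trans (le_b n) (boundP b)).
  by move=> i j le_j; apply: sum_occurs_le => // s t; exact: gap.
by exists C => // w; exact: bal.
Qed.
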